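(* Let $N, n$ be nonnegative integers. Let $G$ be a planar graph with boundary embedded in a disc, having $N$ internal vertices $v_1, v_2, \dots, v_N$ and $n$ boundary vertices $v_{N+1}, v_{N+2}, \dots, v_{N+n}$ in that circular order. Assume $\mathbb{D}(G,\emptyset) > 0$ (which implies that $N$ is even). Then there is an $n\times n$ skew symmetric real matrix $Y$ with the following property: for any subset $I$ of $\partial G$, let $Y_I$ be the submatrix of $Y$ using the rows and columns indexed by $I$. Then $\mathbb{D}(G,I) = \mathrm{Pf}(Y_I)\,\mathbb{D}(G,\emptyset)$ for all subsets $I$ of $\partial G$.
   Context: Graphs are finite and simple, and not assumed bipartite. A graph with boundary is a finite graph $G$ with a specified subset $\partial G$ of its vertices, equipped with a circular ordering. The vertices in $\partial G$ are the boundary vertices; the other vertices are the internal vertices. A graph with boundary is embedded in a disc if $G$ is embedded (without edge crossings) in a closed planar disc $D$ such that the vertices of $\partial G$ lie on the boundary circle $\partial D$, in their specified circular order. A perfect matching of a graph with boundary $G$ is a collection $M$ of edges of $G$ such that each internal vertex is contained in exactly one edge of $M$ and each boundary vertex is contained in at most one edge of $M$. For such $M$, $\partial M$ denotes the set of boundary vertices contained in edges of $M$. For $I \subseteq \partial G$, $\mathbb{D}(G,I)$ denotes the number of perfect matchings $M$ of $G$ with $\partial M = I$. $\mathrm{Pf}$ denotes the Pfaffian; the Pfaffian of an odd by odd skew symmetric matrix is taken to be zero, and that of the empty matrix is $1$. Rows and columns of submatrices are kept in the order they have in the full matrix; the boundary vertex $v_{N+j}$ corresponds to row and column $j$ of $Y$.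 *)

(* Defs.v *)
From mathcomp Require Import all_boot all_order all_algebra all_fingroup.
From mathcomp Require Import all_classical all_reals all_analysis.

Set Implicit Arguments.
Unset Strict Implicit.
Unset Printing Implicit Defensive.

Import Order.TTheory GRing.Theory Num.Theory.
Import numFieldNormedType.Exports.

Local Open Scope ring_scope.

(* The internal vertices are the [lshift n i] and the boundary vertices are the
   [rshift N j]; the circular order on the boundary is the cyclic order of the
   indices [j : 'I_n]. *)
Record bgraph (N n : nat) := BGraph {
  adj : rel 'I_(N + n);
  adj_sym : symmetric adj;
  adj_irr : irreflexive adj
}.

Definition edges N n (G : bgraph N n) : {set {set 'I_(N + n)}} :=
  [set f : {set 'I_(N + n)} |
    [exists u, exists v, adj G u v && (f == [set u; v])]]%SET.

Definition covering N n (M : {set {set 'I_(N + n)}}) (v : 'I_(N + n)) :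
    {set {set 'I_(N + n)}} :=
  [set f in M | v \in f]%SET.

Definition perfect_matching N n (G : bgraph N n) (M : {set {set 'I_(N + n)}}) :
    bool :=
  [&& M \subset edges G,
      [forall i : 'I_N, #|covering M (lshift n i)| == 1%N]
    & [forall j : 'I_n, (#|covering M (rshift N j)| <= 1)%N]].

Definition matching_boundary N n (M : {set {set 'I_(N + n)}}) : {set 'I_n} :=
  [set j : 'I_n | [exists f in M, rshift N j \in f]]%SET.

Definition num_matchings N n (G : bgraph N n) (I : {set 'I_n}) : nat :=
  #|[set M | perfect_matching G M & matching_boundary M == I]%SET|.

Definition closed_disc (R : realType) (c : R * R) (r : R) : set (R * R) :=
  [set p | (p.1 - c.1) ^+ 2 + (p.2 - c.2) ^+ 2 <= r ^+ 2]%classic.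

(* [emb_clockwise] selects the direction in which the boundary vertices are met
   along the circle, so that neither convention is imposed. The curves
   [emb_arc f] matter only for edges [f] and only on [0, 1]. *)
Record disc_embedding (R : realType) N n (G : bgraph N n) := DiscEmbedding {
  emb_center : R * R;
  emb_radius : R;
  emb_radius_gt0 : 0 < emb_radius;
  emb_pos : 'I_(N + n) -> R * R;
  emb_pos_inj : injective emb_pos;
  emb_pos_disc : forall v, closed_disc emb_center emb_radius (emb_pos v);
  emb_clockwise : bool;
  emb_angle : 'I_n -> R;
  emb_angle_lt : forall i j : 'I_n, (i < j)%N -> emb_angle i < emb_angle j;
  emb_angle_lt2pi : forall i j : 'I_n, emb_angle j < emb_angle i + 2 * pi;
  emb_pos_boundary : forall j : 'I_n,
    emb_pos (rshift N j) =
      (emb_center.1 + emb_radius * cos (emb_angle j),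
       emb_center.2 + emb_radius * ((-1) ^+ emb_clockwise * sin (emb_angle j)));
  emb_arc : {set 'I_(N + n)} -> R -> R * R;
  emb_arc_continuous : forall f, f \in edges G ->
    {within `[0, 1], continuous (emb_arc f)}%classic;
  emb_arc_inj : forall f, f \in edges G ->
    {in `[0, 1] &, injective (emb_arc f)};
  emb_arc_ends : forall f, f \in edges G ->
    [set emb_arc f 0; emb_arc f 1]%classic = (emb_pos @` [set` f])%classic;
  emb_arc_disc : forall f t, f \in edges G -> t \in `[0, 1] ->
    closed_disc emb_center emb_radius (emb_arc f t);
  emb_arc_vertex : forall f t v, f \in edges G -> t \in `]0, 1[ ->
    emb_arc f t <> emb_pos v;
  emb_arc_disjoint : forall f g s t, f \in edges G -> g \in edges G -> f != g ->
    s \in `]0, 1[ -> t \in `]0, 1[ -> emb_arc f s <> emb_arc g t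
}.

(* For k even, ordS i is i + 1 at every even i : 'I_k. *)
Definition Pf (R : numFieldType) k (A : 'M[R]_k) : R :=
  if odd k then 0 else
    ((2 ^ k./2 * (k./2)`!)%:R)^-1 *
    \sum_(s : 'S_k) (-1) ^+ s * \prod_(i < k | ~~ odd i) A (s i) (s (ordS i)).

(* enum_val lists I in increasing order. *)
Definition principal_submx (R : Type) n (Y : 'M[R]_n) (I : {set 'I_n}) :
    'M[R]_#|I| :=
  mxsub (@enum_val _ (mem I)) (@enum_val _ (mem I)) Y.

(* Main.v *)
Require Import Defs.
From mathcomp Require Import all_boot all_order all_algebra all_fingroup.
From mathcomp Require Import all_classical all_reals all_analysis.
From mathcomp Require Import ring lra zify.

Set Implicit Arguments.
Unset Strict Implicit.
Unset Printing Implicit Defensive.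

Import Order.TTheory GRing.Theory Num.Theory.
Import numFieldNormedType.Exports.
Local Open Scope ring_scope.

(** Put Y(i, j) = D({i, j}) / D(empty) for i < j and extend it skew-symmetrically.
    Expanding the Pfaffian along its first row, the formula for I follows by
    induction on the size of I from a quadratic relation between matching counts:
    for a fixed vertex a of I, numbering the elements of I as b_0 < b_1 < ...,
      sum_k (-1)^k D({a} ^ {b_k}) D(I \ ({a} ^ {b_k})) = 0,
    where ^ is the symmetric difference ([pfaffian_condensation]).  The term of
    b_k = a is D(empty) D(I), and the others are the terms of the row expansion
    ([Pf_expand]).

    The relation is a sign-reversing involution on superposed pairs of matchings.
    In the union of a matching with boundary {a} ^ {b} and one with boundary
    I \ ({a} ^ {b}), every vertex of I has degree one, so the components meeting I
    are paths that join the vertices of I in pairs ([superposed_end]).  Exchanging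
    the two matchings on the path that starts at b and ends at q replaces b by q
    and nothing else ([flipP]).  The sign changes because b and q occupy positions
    of opposite parity in I: the path from b to q separates the disc, so the
    vertices of I between b and q are matched with each other by the remaining
    paths ([partner_between], [partner_rank]).

    This last point is the only use of planarity: two disjoint connected pieces of
    the drawing cannot join interlaced pairs of boundary points ([noncrossing]).
    It is derived for arbitrary continuous arcs from a two-dimensional
    Poincare-Miranda theorem ([common_zero]), itself proved by a Sperner-type
    counting on a grid ([grid_trilabel]).  For A, B, C, D in this order on the
    circle and l_Z the affine function vanishing on the tangent at Z, the functions
      l_A(x) l_C(y) - l_C(x) l_A(y)   and   l_B(y) l_D(x) - l_D(y) l_B(x)
    satisfy the sign conditions of that theorem for x on a connected set from A to C
    and y on one from B to D, and they vanish together only when x = y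
    ([disc_crossing]). *)

(** * A Poincare-Miranda theorem on a product of two connected compact sets *)

Definition cell (i j : nat) : seq (nat * nat) :=
  [:: (i, j); (i.+1, j); (i, j.+1); (i.+1, j.+1)].

(** With the labels 1 on P, 2 on Q \ P and 3 elsewhere, the antisymmetric edge weight
    w(u, v) = [u is 1][v is 2] - [u is 2][v is 1] sums to zero around every cell that
    misses a label.  If every cell misses one, the weight of horizontal lines is
    therefore the same at the bottom and at the top, since the vertical sides
    carry no weight.  But it is 0 at the top, where label 2 is absent, and 1 at the
    bottom, which runs from label 1 to label 2 without label 3. *)
Lemma grid_trilabel (P Q : pred (nat * nat)) (m n : nat) :
  (forall j, (j <= n)%N -> P (0%N, j)) -> (forall j, (j <= n)%N -> ~~ P (m, j)) ->
  (forall i, (i <= m)%N -> Q (i, 0%N)) -> (forall i, (i <= m)%N -> ~~ Q (i, n)) ->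
  exists i j, [/\ has P (cell i j), has (predD Q P) (cell i j)
    & has (predC (predU P Q)) (cell i j)].
Proof.
move=> Pl Pr Qb Qt; apply: contrapT => no_tri.
pose p u : int := (P u)%:R; pose q u : int := (~~ P u && Q u)%:R.
pose w u v := p u * q v - q u * p v.
have p0 u : ~~ P u -> p u = 0 by rewrite /p => /negPf ->.
have q0P u : P u -> q u = 0 by rewrite /q => ->.
have q0Q u : ~~ Q u -> q u = 0 by rewrite /q => /negPf ->; rewrite andbF.
have qQ u : Q u -> q u = 1 - p u by rewrite /p /q => ->; case: (P u).
have w0p u v : p u = 0 -> p v = 0 -> w u v = 0.
  by rewrite /w => -> ->; rewrite mul0r mulr0 subrr.
have w0q u v : q u = 0 -> q v = 0 -> w u v = 0.
  by rewrite /w => -> ->; rewrite mul0r mulr0 subrr.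
have wQ u v : Q u -> Q v -> w u v = p u - p v.
  by move=> Qu Qv; rewrite /w !qQ //; ring.
have p1 : p (0%N, 0%N) = 1 by rewrite /p Pl.
(* 256 label patterns on the four corners; those with all three labels are excluded. *)
have wcell i j : w (i, j) (i.+1, j) + w (i.+1, j) (i.+1, j.+1) =
                 w (i, j) (i, j.+1) + w (i, j.+1) (i.+1, j.+1).
  have := contra_not (fun h => ex_intro _ i (ex_intro _ j h)) no_tri.
  rewrite /w /p /q /=.
  by case: (P (i, j)); case: (P (i.+1, j)); case: (P (i, j.+1));
     case: (P (i.+1, j.+1)); case: (Q (i, j)); case: (Q (i.+1, j));
     case: (Q (i, j.+1)); case: (Q (i.+1, j.+1)) => //= H; exfalso; apply: H.
(* Forgetting the body of w keeps the additive rewrites below from matching inside it. *)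
move: w w0p w0q wQ wcell => w w0p w0q wQ wcell.
clearbody p q.
pose S k j := \sum_(i < k) w (i : nat, j) (i.+1, j).
have strip j k : S k j + w (k, j) (k, j.+1) = w (0%N, j) (0%N, j.+1) + S k j.+1.
  elim: k => [|k IHk]; first by rewrite /S !big_ord0 addr0 add0r.
  by rewrite /S !big_ord_recr /= -addrA wcell addrA IHk -addrA.
have rows j : (j <= n)%N -> S m 0%N = S m j.
  elim: j => // j IHj ltjn; rewrite (IHj (ltnW ltjn)).
  have wl : w (0%N, j) (0%N, j.+1) = 0 by apply: w0q; apply: q0P; rewrite Pl ?(ltnW ltjn).
  have wr : w (m, j) (m, j.+1) = 0 by apply: w0p; apply: p0; rewrite Pr ?(ltnW ltjn).
  by have := strip j m; rewrite wl wr addr0 add0r.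
have top : S m n = 0.
  by rewrite /S big1 // => i _; apply: w0q; apply: q0Q; rewrite Qt ?(ltnW (ltn_ord i)) ?ltn_ord.
have bottom k : (k <= m)%N -> S k 0%N = p (0%N, 0%N) - p (k, 0%N).
  elim: k => [|k IHk] ltkm; first by rewrite /S big_ord0 subrr.
  rewrite /S big_ord_recr /= -/(S k 0%N) (IHk (ltnW ltkm)) wQ ?Qb ?(ltnW ltkm) //.
  by rewrite addrA subrK.
have := rows n (leqnn n); rewrite top bottom // p1 p0 ?subr0; last exact: Pr.
by move/eqP; rewrite oner_eq0.
Qed.

Section Miranda.
Local Open Scope classical_set_scope.

(** The points reached from x by e-chains form a subset of K that is open and closed
    in K.  Chains provide the integer coordinates that [grid_trilabel] works with. *)
Lemma connected_chain (R : realType) (T : pseudoMetricType R) (K : set T)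
    (x y : T) (e : R) :
  0 < e -> connected K -> K x -> K y ->
  exists m (u : nat -> T), [/\ u 0%N = x, u m = y, forall i, K (u i)
    & forall i, ball (u i) e (u i.+1)].
Proof.
move=> e0 connK Kx Ky.
pose B : set T := [set y | exists m (u : nat -> T),
  [/\ u 0%N = x, u m = y, forall i, K (u i) & forall i, ball (u i) e (u i.+1)]].
have Bext z t : B z -> K t -> ball z e t -> B t.
  case=> m [u [u0 um uK ub]] Kt zt.
  exists m.+1, (fun i => if (i <= m)%N then u i else t).
  rewrite u0 ltnn; split=> // i; first by case: ifP.
  case: (ltngtP i m) => [_|_|->]; [exact: ub|exact: ballxx|by rewrite um].
suff BK : B = K by rewrite -BK in Ky.
have BsubK : B `<=` K by move=> z [m [u [_ <- uK _]]].
apply: connK.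
- exists x; exists 0%N, (fun=> x); split=> // i; exact: ballxx.
- exists (\bigcup_(z in B) (ball z e)°).
    by apply: bigcup_open => z _; exact: open_interior.
  apply/seteqP; split=> z.
    move=> Bz; split; first exact: BsubK.
    by exists z => //; apply: nbhsx_ballx.
  by move=> [Kz [t Bt /interior_subset]]; apply: Bext.
- exists (~` \bigcup_(z in K `\` B) (ball z e)°).
    apply: open_closedC; apply: bigcup_open => z _; exact: open_interior.
  apply/seteqP; split=> z.
    move=> Bz; split; first exact: BsubK.
    move=> [t [Kt nBt] /interior_subset /ball_sym tz]; apply: nBt.
    exact: Bext tz.
  move=> [Kz nz]; apply: contrapT => nBz; apply: nz.
  by exists z => //; apply: nbhsx_ballx.
Qed.

(** The uniform form of a neighbourhood of p that the compactness argument of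
    [common_zero] consumes: it varies the centre and the radius at once. *)
Lemma near_subball (R : realType) (T : pseudoMetricType R) (p : T) (U : set T) :
  nbhs p U -> \forall p' \near p & e \near 0^'+, ball p' (e : R) `<=` U.
Proof.
move=> /nbhs_ballP [e0 /= e0_gt0 sU].
exists (ball p (e0 / 2), [set e | e < e0 / 2]) => /=.
  split; first by apply: nbhsx_ballx; rewrite divr_gt0.
  by apply: nbhs_right_lt; rewrite divr_gt0.
move=> [p' e] /= [pp' lt_e] q p'q; apply: sU.
rewrite [e0]splitr; apply: ball_triangle pp' _.
exact: le_ball (ltW lt_e) _ p'q.
Qed.

(** Without a common zero, f or g has a constant strict sign near each point, and
    compactness gives a single radius e such that no e-ball contains points with
    f < 0, with f >= 0 > g, and with f, g >= 0.  Running e-chains from a to c and from b to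
    d produces a grid on which [grid_trilabel] finds such a ball. *)
Lemma common_zero (R : realType) (T1 T2 : pseudoMetricType R)
    (K1 : set T1) (K2 : set T2) (f g : T1 * T2 -> R) (a c : T1) (b d : T2) :
  compact K1 -> connected K1 -> compact K2 -> connected K2 ->
  continuous f -> continuous g ->
  K1 a -> K1 c -> K2 b -> K2 d ->
  (forall y, K2 y -> f (a, y) < 0) -> (forall y, K2 y -> 0 < f (c, y)) ->
  (forall x, K1 x -> g (x, b) < 0) -> (forall x, K1 x -> 0 < g (x, d)) ->
  exists x y, [/\ K1 x, K2 y, f (x, y) = 0 & g (x, y) = 0].
Proof.
move=> cK1 connK1 cK2 connK2 fC gC K1a K1c K2b K2d fa fc gb gd.
apply: contrapT => nozero.
pose tri (e : R) (p : T1 * T2) := [/\ exists2 q, ball p e q & f q < 0,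
  exists2 q, ball p e q & 0 <= f q /\ g q < 0
  & exists2 q, ball p e q & 0 <= f q /\ 0 <= g q].
have cover : \forall e \near 0^'+, K1 `*` K2 `<=` (fun p => ~ tri e p).
  move/compact_near_coveringP : (compact_setX cK1 cK2); apply.
  move=> p [K1p K2p].
  have nbhs_sign (h : T1 * T2 -> R) (s : R) : continuous h -> 0 < s * h p ->
      nbhs p [set q | 0 < s * h q].
    move=> hC hp.
    have shC : {for p, continuous (fun q => s * h q)}.
      by apply: cvgMr; exact: hC.
    apply: (shC [set r | 0 < r]); exact: lt_nbhsr.
  have : f p != 0 \/ g p != 0.
    apply/orP; rewrite -negb_and; apply/negP => /andP [/eqP fp /eqP gp].
    by apply: nozero; exists p.1, p.2; rewrite -surjective_pairing.
  case; rewrite neq_lt => /orP [] hp.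
  - have /near_subball : nbhs p [set q | 0 < -1 * f q].
      by apply: nbhs_sign => //; lra.
    apply: filterS => -[p' e] /= sub [_ [q /sub /= hq [hf hg]] _]; lra.
  - have /near_subball : nbhs p [set q | 0 < 1 * f q].
      by apply: nbhs_sign => //; lra.
    apply: filterS => -[p' e] /= sub [[q /sub /= hq hf] _ _]; lra.
  - have /near_subball : nbhs p [set q | 0 < -1 * g q].
      by apply: nbhs_sign => //; lra.
    apply: filterS => -[p' e] /= sub [_ _ [q /sub /= hq [hf hg]]]; lra.
  - have /near_subball : nbhs p [set q | 0 < 1 * g q].
      by apply: nbhs_sign => //; lra.
    apply: filterS => -[p' e] /= sub [_ [q /sub /= hq [hf hg]] _]; lra.
have [e [e0 notri]] : exists e : R, 0 < e /\ K1 `*` K2 `<=` (fun p => ~ tri e p).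
  have : \forall e \near 0^'+, 0 < e /\ K1 `*` K2 `<=` (fun p => ~ tri e p).
    by apply: filterI cover; exact: nbhs_right_gt.
  exact: filter_ex.
have [m [u [u0 um uK ub]]] := connected_chain e0 connK1 K1a K1c.
have [n [v [v0 vn vK vb]]] := connected_chain e0 connK2 K2b K2d.
pose pt (k : nat * nat) := (u k.1, v k.2).
have [||||i [j [hP hQ hN]]] := @grid_trilabel (fun k => f (pt k) < 0)
  (fun k => g (pt k) < 0) m n.
- by move=> j _; rewrite /pt /= u0; apply: fa.
- by move=> j _; rewrite /pt /= um -leNgt ltW //; apply: fc.
- by move=> i _; rewrite /pt /= v0; apply: gb.
- by move=> i _; rewrite /pt /= vn -leNgt ltW //; apply: gd.
have near_corner k : k \in cell i j -> ball (u i, v j) e (pt k).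
  rewrite !inE => /or4P [] /eqP -> /=; split=> //=; exact: ballxx.
apply: (notri (u i, v j)); first by split; [exact: uK|exact: vK].
split.
- by case/hasP: hP => k /near_corner kb fk; exists (pt k).
- case/hasP: hQ => k /near_corner kb /andP [/= fk gk]; exists (pt k) => //.
  by rewrite leNgt.
- case/hasP: hN => k /near_corner kb; rewrite /= negb_or => /andP [fk gk].
  by exists (pt k) => //; rewrite !leNgt.
Qed.
End Miranda.

(** * Crossing connected sets in a disc *)

(** Twice the signed area of the triangle XYZ. *)
Definition orient (R : realType) (X Y Z : R * R) : R :=
  (Y.1 - X.1) * (Z.2 - X.2) - (Y.2 - X.2) * (Z.1 - X.1).

(** Twice the area of a triangle inscribed in the unit circle, two of whose arcs are
    2u and 2v: it equals 4 sin u sin v sin (u + v). *)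
Lemma sin_triangle_gt0 (R : realType) (u v : R) :
  0 < u -> 0 < v -> u + v < pi ->
  0 < sin (u + u) + sin (v + v) - sin (u + u + (v + v)).
Proof.
move=> u0 v0 uv.
have su : 0 < sin u by apply: sin_gt0_pi; lra.
have sv : 0 < sin v by apply: sin_gt0_pi; lra.
have suv : 0 < sin (u + v) by apply: sin_gt0_pi; lra.
have -> : sin (u + u) + sin (v + v) - sin (u + u + (v + v)) =
          4 * (sin u * sin v * sin (u + v)).
  have cu := cos2Dsin2 u; have cv := cos2Dsin2 v.
  rewrite (sinD (u + u)) !(sinD, cosD).
  have -> : cos u * cos u = 1 - sin u * sin u by rewrite -cu; ring.
  have -> : cos v * cos v = 1 - sin v * sin v by rewrite -cv; ring.
  ring.
by rewrite mulr_gt0 // !mulr_gt0.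
Qed.

(** The factor e stands for a sign, which selects the direction of travel. *)
Definition circle_pt (R : realType) (c : R * R) (r e t : R) : R * R :=
  (c.1 + r * cos t, c.2 + r * (e * sin t)).

Lemma orient_circle (R : realType) (c : R * R) (r e t1 t2 t3 : R) :
  0 < r -> t1 < t2 -> t2 < t3 -> t3 < t1 + 2 * pi ->
  e != 0 ->
  0 < e * orient (circle_pt c r e t1) (circle_pt c r e t2) (circle_pt c r e t3).
Proof.
move=> r0 t12 t23 t31 e0.
have ee : 0 < e * e by rewrite -expr2 exprn_even_gt0.
pose u := (t2 - t1) / 2; pose v := (t3 - t2) / 2.
have := @sin_triangle_gt0 R u v.
have -> : u + u = t2 - t1 by rewrite /u; field.
have -> : v + v = t3 - t2 by rewrite /v; field.
have -> : t2 - t1 + (t3 - t2) = t3 - t1 by ring.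
rewrite !sinB => pos.
have {}pos := pos ltac:(rewrite /u; lra) ltac:(rewrite /v; lra)
                  ltac:(rewrite /u /v; lra).
rewrite /orient /circle_pt /=.
set E := (X in 0 < X) in pos; rewrite (_ : e * _ = e * e * (r * r) * E).
  by apply: mulr_gt0 => //; apply: mulr_gt0 => //; exact: mulr_gt0.
by rewrite /E; ring.
Qed.

Section DiscCrossing.
Local Open Scope classical_set_scope.

(** Let l_Z be the affine function which is 0 on the tangent at Z and positive
    elsewhere on the disc.  A common zero of the two functions f and g below is a pair
    (x, y) at which l_A : l_C takes the same ratio, and l_B : l_D as well.  Because the
    chords AC and BD meet, some positive combination of l_A and l_C equals one of
    l_B and l_D; calling it m, each of the four functions has at x and y the ratio
    m(x) : m(y).  Three of them span the affine functions, so constants scale by this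
    factor too: it is 1, and x = y.  Geometrically, x and y would lie on the line
    through the poles of the two chords, which is the polar of the point where the
    chords cross and so misses the disc. *)
Lemma disc_crossing (R : realType) (c : R * R) (r : R) (K1 K2 : set (R * R))
    (A B C D : R * R) :
  0 < r -> compact K1 -> connected K1 -> compact K2 -> connected K2 ->
  K1 `<=` closed_disc c r -> K2 `<=` closed_disc c r ->
  K1 A -> K2 B -> K1 C -> K2 D ->
  {in [:: A; B; C; D], forall Z, (Z.1 - c.1) ^+ 2 + (Z.2 - c.2) ^+ 2 = r ^+ 2} ->
  0 < orient A B C -> 0 < orient B C D -> 0 < orient C D A ->
  0 < orient D A B -> K1 `&` K2 !=set0.
Proof.
move=> r0 cK1 connK1 cK2 connK2 K1disc K2disc K1A K2B K1C K2D circ ABC BCD CDA DAB.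
apply/set0P/eqP => K12.
have neqK x y : K1 x -> K2 y -> x <> y.
  by move=> K1x K2y xy; rewrite -[False]/(set0 x) -K12; split; rewrite // xy.
pose l (Z p : R * R) :=
  r ^+ 2 - ((p.1 - c.1) * (Z.1 - c.1) + (p.2 - c.2) * (Z.2 - c.2)).
have lC Z : continuous (l Z).
  move=> p; apply: cvgB; first exact: cvg_cst.
  by apply: cvgD; apply: cvgMl; apply: cvgB; do ?exact: cvg_cst;
     [exact: cvg_fst|exact: cvg_snd].
have l0 Z : Z \in [:: A; B; C; D] -> l Z Z = 0.
  by move=> /circ; rewrite /l => <-; ring.
have lgt0 Z p : Z \in [:: A; B; C; D] -> closed_disc c r p -> Z <> p -> 0 < l Z p.
  move=> /circ Zr pr Zp.
  have : 0 < (Z.1 - p.1) ^+ 2 + (Z.2 - p.2) ^+ 2.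
    rewrite lt_def addr_ge0 ?sqr_ge0 // andbT paddr_eq0 ?sqr_ge0 //.
    rewrite !sqrf_eq0 !subr_eq0; apply/negP => /andP [/eqP e1 /eqP e2].
    by apply: Zp; rewrite [Z]surjective_pairing [p]surjective_pairing e1 e2.
  move: pr Zr; rewrite /closed_disc /l /=; nra.
have inA : A \in [:: A; B; C; D] by rewrite inE eqxx.
have inB : B \in [:: A; B; C; D] by rewrite !inE eqxx orbT.
have inC : C \in [:: A; B; C; D] by rewrite !inE eqxx !orbT.
have inD : D \in [:: A; B; C; D] by rewrite !inE eqxx !orbT.
have AC : A <> C by move=> e; move: ABC; rewrite e /orient; lra.
have BD : B <> D by move=> e; move: BCD; rewrite e /orient; lra.
have lAC : 0 < l A C by apply: lgt0 => //; exact: K1disc.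
have lCA : 0 < l C A by apply: lgt0 => //; [exact: K1disc|exact/nesym].
have lBD : 0 < l B D by apply: lgt0 => //; exact: K2disc.
have lDB : 0 < l D B by apply: lgt0 => //; [exact: K2disc|exact/nesym].
pose f (p : (R * R) * (R * R)) := l A p.1 * l C p.2 - l C p.1 * l A p.2.
pose g (p : (R * R) * (R * R)) := l B p.2 * l D p.1 - l D p.2 * l B p.1.
have l1C Z : continuous (fun p : (R * R) * (R * R) => l Z p.1).
  by move=> p; apply: continuous_comp; [exact: cvg_fst|exact: lC].
have l2C Z : continuous (fun p : (R * R) * (R * R) => l Z p.2).
  by move=> p; apply: continuous_comp; [exact: cvg_snd|exact: lC].
have fC : continuous f.
  move=> p; apply: cvgB; first exact: cvgM (l1C A p) (l2C C p).
  exact: cvgM (l1C C p) (l2C A p).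
have gC : continuous g.
  move=> p; apply: cvgB; first exact: cvgM (l2C B p) (l1C D p).
  exact: cvgM (l2C D p) (l1C B p).
have [||||x [y [K1x K2y fxy gxy]]] :=
  common_zero cK1 connK1 cK2 connK2 fC gC K1A K1C K2B K2D.
- move=> y K2y; rewrite /f /= l0 // mul0r sub0r oppr_lt0 mulr_gt0 //.
  by apply: lgt0 => //; [exact: K2disc|exact: neqK].
- move=> y K2y; rewrite /f /= (l0 C) // mul0r subr0 mulr_gt0 //.
  by apply: lgt0 => //; [exact: K2disc|exact: neqK].
- move=> x K1x; rewrite /g /= l0 // mul0r sub0r oppr_lt0 mulr_gt0 //.
  by apply: lgt0 => //; [exact: K1disc|exact/nesym/neqK].
- move=> x K1x; rewrite /g /= (l0 D) // mul0r subr0 mulr_gt0 //.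
  by apply: lgt0 => //; [exact: K1disc|exact/nesym/neqK].
apply: (neqK x y) => //.
have lge0 Z p : Z \in [:: A; B; C; D] -> closed_disc c r p -> 0 <= l Z p.
  move=> ZZ pr; have [<-|/eqP Zp] := eqVneq Z p; first by rewrite l0.
  exact/ltW/lgt0.
(* The barycentric relation of the convex quadrilateral ABCD, where the diagonals cross. *)
pose m p := orient B C D * l A p + orient D A B * l C p.
have mE p : m p = orient C D A * l B p + orient A B C * l D p.
  by rewrite /m /l /orient; ring.
have m0 : 0 < m x.
  have [Ax|/eqP Ax] := eqVneq A x.
    by rewrite /m -Ax l0 // mulr0 add0r mulr_gt0.
  apply: ltr_wpDr; first by apply: mulr_ge0; [exact: ltW|apply: lge0 => //; exact: K1disc].
  by rewrite mulr_gt0 //; apply: lgt0 => //; exact: K1disc.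
rewrite /f /= in fxy; rewrite /g /= in gxy.
have hA : m y * l A x = m x * l A y.
  have -> : m y * l A x = m x * l A y + orient D A B * (l A x * l C y - l C x * l A y).
    by rewrite /m; ring.
  by rewrite fxy mulr0 addr0.
have hC : m y * l C x = m x * l C y.
  have -> : m y * l C x = m x * l C y - orient B C D * (l A x * l C y - l C x * l A y).
    by rewrite /m; ring.
  by rewrite fxy mulr0 subr0.
have hB : m y * l B x = m x * l B y.
  have -> : m y * l B x = m x * l B y - orient A B C * (l B y * l D x - l D y * l B x).
    by rewrite !mE; ring.
  by rewrite gxy mulr0 subr0.
move: (m x) (m y) m0 hA hB hC => mx my m0 hA hB hC.
(* (W1, W2) is orthogonal to two independent sides of the triangle ABC. *)
pose W1 := my * (x.1 - c.1) - mx * (y.1 - c.1).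
pose W2 := my * (x.2 - c.2) - mx * (y.2 - c.2).
have WB : W1 * (B.1 - A.1) + W2 * (B.2 - A.2) = 0.
  by move: hA hB; rewrite /l /W1 /W2 => hA hB; lra.
have WC : W1 * (C.1 - A.1) + W2 * (C.2 - A.2) = 0.
  by move: hA hC; rewrite /l /W1 /W2 => hA hC; lra.
have W10 : W1 = 0.
  apply: (mulIf (lt0r_neq0 ABC)); rewrite mul0r.
  have -> : W1 * orient A B C = (W1 * (B.1 - A.1) + W2 * (B.2 - A.2)) * (C.2 - A.2)
      - (W1 * (C.1 - A.1) + W2 * (C.2 - A.2)) * (B.2 - A.2).
    by rewrite /orient; ring.
  by rewrite WB WC !mul0r subrr.
have W20 : W2 = 0.
  apply: (mulIf (lt0r_neq0 ABC)); rewrite mul0r.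
  have -> : W2 * orient A B C = (W1 * (C.1 - A.1) + W2 * (C.2 - A.2)) * (B.1 - A.1)
      - (W1 * (B.1 - A.1) + W2 * (B.2 - A.2)) * (C.1 - A.1).
    by rewrite /orient; ring.
  by rewrite WB WC !mul0r subrr.
have mxy : my = mx.
  apply: (mulIf (lt0r_neq0 (exprn_gt0 2 r0))); apply/eqP; rewrite -subr_eq0.
  have -> : my * r ^+ 2 - mx * r ^+ 2 = my * l A x - mx * l A y +
      W1 * (A.1 - c.1) + W2 * (A.2 - c.2) by rewrite /l /W1 /W2; ring.
  by rewrite hA W10 W20 !mul0r subrr !addr0.
have {W10 W20} [e1 e2] : x.1 = y.1 /\ x.2 = y.2.
  split; apply: (mulfI (lt0r_neq0 m0)).
    by move: W10; rewrite /W1 mxy; lra.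
  by move: W20; rewrite /W2 mxy; lra.
by rewrite [x]surjective_pairing [y]surjective_pairing e1 e2.
Qed.
End DiscCrossing.

(** * Walks between interlaced boundary vertices *)

Lemma orient_rot (R : realType) (X Y Z : R * R) : orient X Y Z = orient Y Z X.
Proof. by rewrite /orient; ring. Qed.

Lemma orient_opp (R : realType) (X Y Z : R * R) : -1 * orient X Y Z = orient Z Y X.
Proof. by rewrite /orient; ring. Qed.

Section NonCrossing.
Local Open Scope classical_set_scope.
Variables (R : realType) (N n : nat) (G : bgraph N n) (emb : disc_embedding R G).

Lemma edge_arc (u v : 'I_(N + n)) : adj G u v ->
  let f := [set u; v]%SET in let K := emb_arc emb f @` `[0, 1] in
  [/\ f \in edges G, compact K /\ connected K,
      K `<=` closed_disc (emb_center emb) (emb_radius emb),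
      K (emb_pos emb u) /\ K (emb_pos emb v)
    & forall z, K z -> (exists2 w, w \in f & z = emb_pos emb w) \/
        exists2 t, t \in `]0, 1[%R & z = emb_arc emb f t].
Proof.
move=> uv f K.
have fG : f \in edges G.
  by rewrite inE; apply/existsP; exists u; apply/existsP; exists v; rewrite uv eqxx.
have ends := emb_arc_ends emb fG.
have in01 : (0 : R) \in `[0, 1]%R /\ (1 : R) \in `[0, 1]%R.
  by rewrite !in_itv /= !lexx ler01.
have Kends w : w \in f -> K (emb_pos emb w).
  move=> wf; have : [set emb_arc emb f 0; emb_arc emb f 1] (emb_pos emb w).
    by rewrite ends; exists w.
  by case=> ->; [exists 0|exists 1] => //; case: in01.
split=> //.
- split; first by apply: continuous_compact; [exact: emb_arc_continuous|exact: segment_compact].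
  apply: connected_continuous_connected; first exact: segment_connected.
  exact: emb_arc_continuous.
- by move=> z [t t01 <-]; apply: emb_arc_disc.
- by split; apply: Kends; rewrite !inE eqxx ?orbT.
- have Kpos t : t = 0 \/ t = 1 -> exists2 w, w \in f & emb_arc emb f t = emb_pos emb w.
    move=> t01; have : (emb_pos emb @` [set` f]) (emb_arc emb f t).
      by rewrite -ends; case: t01 => ->; [left|right].
    by case=> w wf <-; exists w.
  move=> z [t /= t01 <-].
  have [t0|t0] := eqVneq t 0; first by left; apply: Kpos; left.
  have [t1|t1] := eqVneq t 1; first by left; apply: Kpos; right.
  right; exists t => //; move: t01; rewrite !in_itv /= => /andP [t0' t1'].
  by rewrite !lt_def t0 t0' eq_sym t1 t1'.
Qed.

(** The carrier is the union of the arcs drawn along the walk.  The last clause records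
    that it meets only the part of the drawing that belongs to the component of x,
    which is what makes the carriers of different components disjoint. *)
Lemma walk_carrier (e : rel 'I_(N + n)) (x y : 'I_(N + n)) :
  (forall u v, e u v -> u != v -> adj G u v) -> connect e x y ->
  exists K : set (R * R), [/\ compact K, connected K,
      K `<=` closed_disc (emb_center emb) (emb_radius emb),
      K (emb_pos emb x) /\ K (emb_pos emb y)
    & forall z, K z -> (exists2 w, connect e x w & z = emb_pos emb w) \/
        exists f t, [/\ f \in edges G, t \in `]0, 1[%R, z = emb_arc emb f t &
          forall w, w \in f -> connect e x w]].
Proof.
move=> eG /connectP [p + ->] {y}; elim: p x => [|y p IHp] x /=.
  move=> _; exists [set emb_pos emb x]; split=> //.
  - exact: compact_set1.
  - exact: connected1.
  - by move=> _ ->; apply: emb_pos_disc.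
  - by move=> _ ->; left; exists x.
case/andP=> exy /IHp [K [cK connK Kdisc [Ky Kl] Kz]].
have exy1 := connect1 exy.
have Kz' z : K z -> (exists2 w, connect e x w & z = emb_pos emb w) \/
        exists f t, [/\ f \in edges G, t \in `]0, 1[%R, z = emb_arc emb f t &
          forall w, w \in f -> connect e x w].
  case/Kz => [[w yw ->]|[f [t [fG t01 -> fy]]]].
    by left; exists w => //; apply: connect_trans yw.
  by right; exists f, t; split=> // w /fy; apply: connect_trans.
have [xy|xy] := eqVneq x y; first by exists K; rewrite {1}xy.
have [/= fG [cA connA] Adisc [Ax Ay] Az] := edge_arc (eG _ _ exy xy).
have fx w : w \in [set x; y]%SET -> connect e x w.
  by rewrite !inE => /orP [] /eqP -> //; exact: connect0.
exists ((emb_arc emb [set x; y]%SET @` `[0, 1]) `|` K); split.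
- exact: compactU.
- by apply: connectedU => //; exists (emb_pos emb y).
- by move=> z [/Adisc|/Kdisc].
- by split; [left|right].
- move=> z [/Az|/Kz' //] [[w wf ->]|[t t01 ->]].
    by left; exists w => //; apply: fx.
  by right; exists [set x; y]%SET, t.
Qed.

(** Otherwise the two walks lie in different components, so their carriers are
    disjoint, although they join interlaced points of the circle. *)
Lemma noncrossing (e : rel 'I_(N + n)) (a b c d : 'I_n) :
  symmetric e -> (forall u v, e u v -> u != v -> adj G u v) ->
  (a < b)%N -> (b < c)%N -> (c < d)%N ->
  connect e (rshift N a) (rshift N c) -> connect e (rshift N b) (rshift N d) ->
  connect e (rshift N a) (rshift N b).
Proof.
move=> e_sym eG ab bc cd ac bd; apply/negPn/negP => nab.
have csym := sym_connect_sym e_sym.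
have [K1 [cK1 connK1 K1disc [K1a K1c] K1z]] := walk_carrier eG ac.
have [K2 [cK2 connK2 K2disc [K2b K2d] K2z]] := walk_carrier eG bd.
have disj w : connect e (rshift N a) w -> connect e (rshift N b) w -> False.
  by move=> aw bw; move/negP: nab; apply; apply: connect_trans aw _; rewrite csym.
suff [z [/K1z z1 /K2z z2]] : K1 `&` K2 !=set0.
  case: z1 => [[v av zv]|[f [s [fG s01 zf af]]]];
  case: z2 => [[w bw zw]|[g [t [gG t01 zg bg]]]].
  - have vw : v = w by apply: (emb_pos_inj (d := emb)); rewrite -zv.
    by apply: (disj v) => //; rewrite vw.
  - by case: (emb_arc_vertex (d := emb) (v := v) gG t01); rewrite -zg.
  - by case: (emb_arc_vertex (d := emb) (v := w) fG s01); rewrite -zf.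
  - have [fg|fg] := eqVneq f g; last first.
      by case: (emb_arc_disjoint (d := emb) fG gG fg s01 t01); rewrite -zf.
    move: fG; rewrite inE => /existsP [u /existsP [v /andP [_ /eqP fuv]]].
    have uf : u \in f by rewrite fuv !inE eqxx.
    by apply: (disj u); [exact: af|apply: bg; rewrite -fg].
pose th := emb_angle emb; pose s : R := (-1) ^+ emb_clockwise emb.
have posE j : emb_pos emb (rshift N j) =
    circle_pt (emb_center emb) (emb_radius emb) s (th j).
  exact: emb_pos_boundary.
have r0 := emb_radius_gt0 emb.
have s2 : s * s = 1 by rewrite /s -expr2 sqrr_sign.
have circ j Z : Z = emb_pos emb (rshift N j) ->
    (Z.1 - (emb_center emb).1) ^+ 2 + (Z.2 - (emb_center emb).2) ^+ 2 = emb_radius emb ^+ 2.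
  move=> ->; rewrite posE /circle_pt /=.
  rewrite -[RHS]mulr1 -(cos2Dsin2 (th j)) -[sin (th j) ^+ 2]mul1r -s2; ring.
have orient_pos i j k : th i < th j -> th j < th k -> th k < th i + 2 * pi ->
    0 < s * orient (emb_pos emb (rshift N i)) (emb_pos emb (rshift N j))
                   (emb_pos emb (rshift N k)).
  by move=> ij jk ki; rewrite !posE; apply: orient_circle; rewrite // /s signr_eq0.
have tab : th a < th b := emb_angle_lt emb ab.
have tbc : th b < th c := emb_angle_lt emb bc.
have tcd : th c < th d := emb_angle_lt emb cd.
have tda : th d < th a + 2 * pi := emb_angle_lt2pi emb a d.
have [se|se] : s = 1 \/ s = -1 by rewrite /s; case: (emb_clockwise _); [right|left].
- apply: (disc_crossing r0 cK1 connK1 cK2 connK2 K1disc K2disc K1a K2b K1c K2d).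
  + by move=> Z; rewrite !inE => /or4P [] /eqP; apply: circ.
  + by have := orient_pos a b c tab tbc; rewrite se mul1r; apply; lra.
  + by have := orient_pos b c d tbc tcd; rewrite se mul1r; apply; lra.
  + by have := orient_pos a c d; rewrite se mul1r orient_rot; apply; lra.
  + by have := orient_pos a b d; rewrite se mul1r -orient_rot; apply; lra.
- apply: (disc_crossing r0 cK1 connK1 cK2 connK2 K1disc K2disc K1c K2b K1a K2d).
  + by move=> Z; rewrite !inE => /or4P [] /eqP; apply: circ.
  + by have := orient_pos a b c tab tbc; rewrite se orient_opp; apply; lra.
  + by have := orient_pos a b d; rewrite se orient_opp orient_rot; apply; lra.
  + by have := orient_pos a c d; rewrite se orient_opp -orient_rot; apply; lra.
  + by have := orient_pos b c d; rewrite se orient_opp; apply; lra.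
Qed.
End NonCrossing.

(** * Alternating walks of two involutions *)

Section AlternatingWalk.
Variables (T : finType) (m1 m2 : T -> T).
Hypotheses (m1K : involutive m1) (m2K : involutive m2).

(** The walk from x is the orbit y_0 = x, y_1, ... of m1 o m2, closing up after L steps.
    As m1 fixes x, the involutions act on it as the reflections m1 : y_i -> y_(L - i) and
    m2 : y_i -> y_(L - 1 - i) of a cycle of length L.  Besides x the only fixed point
    of either reflection is y_(L / 2), of m1 for even L and of m2 for odd L. *)
Lemma alternating_walk_end (e : rel T) (x : T) :
  (forall u v, e u v -> v = m1 u \/ v = m2 u) ->
  (forall u, m1 u != u -> e u (m1 u)) -> (forall u, m2 u != u -> e u (m2 u)) ->
  m1 x = x -> m2 x != x ->
  exists y, [/\ y != x, connect e x y, m1 y = y \/ m2 y = y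
    & forall z, connect e x z -> m1 z = z \/ m2 z = z -> z = x \/ z = y].
Proof.
move=> eE e1 e2 m1x m2x.
pose s := m1 \o m2.
have injs : injective s by apply: inj_comp; apply: can_inj; eassumption.
pose L := fingraph.order s x; pose y i := iter i s x.
have L0 : (0 < L)%N by exact: fingraph.order_gt0.
have yL : y L = x by exact: fingraph.iter_order.
have yS i : y i.+1 = m1 (m2 (y i)) by [].
have m1y i : (i <= L)%N -> m1 (y i) = y (L - i)%N.
  elim: i => [|i IHi] ltiL; first by rewrite subn0 yL.
  rewrite yS m1K; apply: (can_inj m2K); rewrite m2K.
  apply: (can_inj m1K); rewrite -yS IHi 1?ltnW //.
  by rewrite subnSK.
have m2y i : (i < L)%N -> m2 (y i) = y (L - i.+1)%N.
  by move=> ltiL; rewrite -m1y // yS m1K.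
have yinj i j : (i < L)%N -> (j < L)%N -> y i = y j -> i = j.
  by move=> iL jL /(congr1 (findex s x)); rewrite !findex_iter.
have conn i : connect e x (y i).
  elim: i => // i IHi; apply: connect_trans IHi _; rewrite yS.
  have step1 u : connect e u (m1 u).
    by have [->|/e1/connect1] := eqVneq (m1 u) u.
  have step2 u : connect e u (m2 u).
    by have [->|/e2/connect1] := eqVneq (m2 u) u.
  exact: connect_trans (step2 _) (step1 _).
have L1 : (1 < L)%N.
  rewrite ltn_neqAle L0 andbT; apply: contraNneq m2x => L_1.
  by move: (m2y 0%N L0); rewrite -L_1 subnn /y /= => ->.
have onwalk z : connect e x z -> exists2 i, (i < L)%N & z = y i.
  case/connectP=> p; elim/last_ind: p z => [|p u IHp] z /=; first by move=> _ ->; exists 0%N.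
  rewrite rcons_path last_rcons => /andP [/IHp/(_ erefl) [i iL ->] /eE zE] ->.
  case: zE => ->; last by rewrite m2y //; exists (L - i.+1)%N => //; lia.
  rewrite m1y 1?ltnW //; case: i iL => [|i] iL; last by exists (L - i.+1)%N => //; lia.
  by exists 0%N; rewrite ?subn0.
have half : (L./2 < L)%N by lia.
exists (y L./2); split.
- apply: contraTneq L1 => /(yinj _ 0%N half L0); lia.
- exact: conn.
- have [oddL|evenL] := boolP (odd L); [right; rewrite m2y //|left; rewrite m1y 1?ltnW //];
    congr y; lia.
- move=> _ /onwalk [i iL ->] [fix1|fix2]; last first.
    right; congr y; have := yinj (L - i.+1)%N i; rewrite -m2y // => /(_ _ iL fix2); lia.
  case: i iL fix1 => [|i] iL fix1; first by left.
  have /yinj inj : y (L - i.+1)%N = y i.+1 by rewrite -m1y // ltnW.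
  by right; congr y; have := inj ltac:(lia) iL; lia.
Qed.
End AlternatingWalk.

(** The involution exchanges the elements that it raises with those that it lowers. *)
Lemma even_card_involution (n : nat) (A : {set 'I_n}) (p : 'I_n -> 'I_n) :
  {in A, forall x, [/\ p x \in A, p (p x) = x & p x != x]} -> ~~ odd #|A|.
Proof.
move=> Ap.
have up : #|[set x in A | (x < p x)%N]%SET| = #|[set x in A | (p x < x)%N]%SET|.
  rewrite -(card_in_imset (f := p) (D := [set x in A | (x < p x)%N]%SET)).
    apply: eq_card => x; rewrite !inE; apply/imsetP/andP.
      by case=> z; rewrite inE => /andP [/Ap [pzA pzK _] ltz] ->; rewrite pzK.
    by case=> /Ap [pxA pxK _] ltx; exists (p x); rewrite ?inE ?pxK ?pxA.
  move=> x z; rewrite !inE => /andP [/Ap [_ xK _] _] /andP [/Ap [_ zK _] _] xz.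
  by rewrite -xK xz zK.
have -> : #|A| = (#|[set x in A | (x < p x)%N]%SET| + #|[set x in A | (p x < x)%N]%SET|)%N.
  rewrite -cardsUI [X in (_ + X)%N]eq_card0 ?addn0; last first.
    by move=> x; rewrite !inE; case: ltngtP; rewrite !andbF.
  apply: eq_card => x; rewrite !inE; have [/Ap [_ _ px]|//] := boolP (x \in A).
  by case: ltngtP => //= /val_inj px'; rewrite -px' eqxx in px.
by rewrite up addnn odd_double.
Qed.

(** * Matchings and their superposition *)

Section Matchings.
Local Open Scope set_scope.
Variables (N n : nat) (G : bgraph N n).
Local Notation V := 'I_(N + n).
Implicit Types (M : {set {set V}}) (f : {set V}).

Definition covered M (v : V) := [exists f in M, v \in f].

Lemma covered_card M v : covered M v = (0 < #|covering M v|)%N.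
Proof.
rewrite card_gt0; apply/existsP/set0Pn => -[f].
  by case/andP=> fM vf; exists f; rewrite inE fM.
by rewrite inE => fMv; exists f.
Qed.

Lemma perfect_matchingP M :
  reflect [/\ M \subset edges G,
     forall v f g, f \in M -> g \in M -> v \in f -> v \in g -> f = g
   & forall i : 'I_N, covered M (lshift n i)] (perfect_matching G M).
Proof.
apply: (iffP and3P) => -[MG h1 h2]; split=> //.
- move=> v f g fM gM vf vg.
  have : (#|covering M v| <= 1)%N.
    case: (split_ordP v) => k ->; last exact: (forallP h2).
    by rewrite (eqP (forallP h1 k)).
  by move/card_le1P => /(_ f); rewrite inE fM vf => /(_ isT g); rewrite !inE gM vg => /esym/eqP.
- by move=> i; rewrite covered_card (eqP (forallP h1 i)).
- apply/forallP => i; rewrite eqn_leq -covered_card h2 andbT.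
  apply/card_le1P => f; rewrite inE => /andP [fM vf] g; rewrite !inE.
  apply/andP/eqP => [[gM vg]|->] //; exact: h1 vf.
- apply/forallP => i.
  apply/card_le1P => f; rewrite inE => /andP [fM vf] g; rewrite !inE.
  apply/andP/eqP => [[gM vg]|->] //; exact: h1 vf.
Qed.

Lemma edgesP f : reflect (exists u v, adj G u v /\ f = [set u; v]) (f \in edges G).
Proof.
rewrite inE; apply: (iffP existsP) => [[u /existsP [v /andP [uv /eqP ->]]]|[u [v [uv ->]]]].
  by exists u, v.
by exists u; apply/existsP; exists v; rewrite uv eqxx.
Qed.

Lemma edge_adj (u v : V) : [set u; v] \in edges G -> adj G u v.
Proof.
case/edgesP=> a [b [ab /setP uv]].
have anb : a != b by apply: contraTneq ab => ->; rewrite adj_irr.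
have := uv a; have := uv b; have := uv u; have := uv v; rewrite !inE !eqxx !orbT /=.
move=> /esym/orP [] /eqP -> /esym/orP [] /eqP ->; rewrite ?orbb ?eqxx //.
- by move=> /eqP ba; rewrite ba eqxx in anb.
- by rewrite adj_sym.
- by move=> _ /eqP ba; rewrite ba eqxx in anb.
Qed.

(** The value v at uncovered vertices makes the mate an involution of all the vertices,
    whose fixed points are the uncovered ones. *)
Definition mate M v := if [pick u | [set v; u] \in M] is Some u then u else v.

Definition superposed M1 M2 : rel V := fun u v => [set u; v] \in M1 :|: M2.

Lemma superposed_sym M1 M2 : symmetric (superposed M1 M2).
Proof. by move=> u v; rewrite /superposed finset.setUC. Qed.

Section Mate.
Variable M : {set {set V}}.
Hypothesis pmM : perfect_matching G M.

Lemma mate_edge v u : [set v; u] \in M -> mate M v = u.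
Proof.
move=> vuM; have [MG M1 _] := perfect_matchingP _ pmM.
have vu := edge_adj (fintype.subsetP MG _ vuM).
rewrite /mate; case: pickP => [w vwM|/(_ u)]; last by rewrite vuM.
have /setP/(_ u) := M1 v _ _ vwM vuM (set21 _ _) (set21 _ _).
rewrite !inE eqxx orbT => /orP [] /eqP // uv.
by rewrite -uv adj_irr in vu.
Qed.

Lemma covered_edge v : covered M v -> [set v; mate M v] \in M.
Proof.
case/existsP=> f /andP [fM vf]; have [MG _ _] := perfect_matchingP _ pmM.
have [u [w [_ fE]]] := edgesP _ (fintype.subsetP MG _ fM).
have [x fx] : exists x, f = [set v; x].
  by move: vf; rewrite fE !inE => /orP [] /eqP ->; [exists w|exists u; rewrite finset.setUC].
by rewrite fx in fM; rewrite (mate_edge fM).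
Qed.

Lemma mate_covered v : (mate M v != v) = covered M v.
Proof.
have [MG _ _] := perfect_matchingP _ pmM.
apply/idP/idP => [|/covered_edge vM].
  rewrite /mate; case: pickP => [u vuM _|_]; last by rewrite eqxx.
  by apply/existsP; exists [set v; u]; rewrite vuM set21.
have := edge_adj (fintype.subsetP MG _ vM).
by apply: contraTneq => ->; rewrite adj_irr.
Qed.

Lemma mateK : involutive (mate M).
Proof.
move=> v; have [/covered_edge vM|] := boolP (covered M v).
  by rewrite (@mate_edge (mate M v) v) // finset.setUC.
by rewrite -mate_covered negbK => /eqP fix_v; rewrite !fix_v.
Qed.
End Mate.

(** A vertex covered by exactly one of the matchings is an end of its component, which
    is an alternating path and so has exactly one other end. *)
Lemma superposed_end (M1 M2 : {set {set V}}) (x : V) :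
  perfect_matching G M1 -> perfect_matching G M2 ->
  covered M1 x (+) covered M2 x ->
  exists y, [/\ y != x, connect (superposed M1 M2) x y, covered M1 y (+) covered M2 y
   & forall z, connect (superposed M1 M2) x z -> covered M1 z (+) covered M2 z ->
       z = x \/ z = y].
Proof.
wlog : M1 M2 / ~~ covered M1 x.
  move=> hw pm1 pm2 x1; have [c1|n1] := boolP (covered M1 x); last exact: hw.
  have [||y [yx xy yc yu]] := hw M2 M1 _ pm2 pm1.
  - by rewrite c1 /= in x1.
  - by rewrite addbC.
  have sC : superposed M2 M1 =2 superposed M1 M2.
    by move=> u v; rewrite /superposed (finset.setUC M2).
  exists y; split; rewrite -1?(eq_connect sC) 1?addbC // => z.
  by rewrite -(eq_connect sC) addbC; exact: yu.
move=> n1 pm1 pm2; rewrite (negPf n1) /= => c2.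
have e1 M u : perfect_matching G M -> mate M u != u -> [set u; mate M u] \in M.
  by move=> pm; rewrite mate_covered // => /covered_edge; apply.
have [|||||y [yx xy fy yu]] := @alternating_walk_end _ (mate M1) (mate M2)
    (mateK pm1) (mateK pm2) (superposed M1 M2) x.
- by move=> u v; rewrite /superposed inE => /orP [] /mate_edge <- //; [left|right].
- by move=> u /e1 uM; rewrite /superposed inE uM.
- by move=> u /e1 uM; rewrite /superposed inE uM // orbT.
- by apply/eqP; rewrite -[_ == _]negbK mate_covered.
- by rewrite mate_covered.
have fixE M u : perfect_matching G M -> (mate M u = u) <-> ~~ covered M u.
  by move=> pm; rewrite -mate_covered // negbK; split=> /eqP.
have conn_covered z : connect (superposed M1 M2) x z -> z != x -> covered M1 z || covered M2 z.
  rewrite (sym_connect_sym (superposed_sym M1 M2)) => /connectP [[|u p] /=].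
    by move=> _ ->; rewrite eqxx.
  case/andP; rewrite /superposed inE => zu _ _ _.
  by case/orP: zu => zu; apply/orP; [left|right];
     apply/existsP; exists [set z; u]; rewrite zu set21.
exists y; split=> //.
  have := conn_covered y xy yx.
  by case: fy => /fixE -/(_ _)/negPf -> //=; rewrite ?orbF ?addbF.
move=> z xz zc; apply: yu => //; case c1: (covered M1 z) zc => /=.
  by move=> n2; right; apply/fixE.
by left; apply/fixE => //; rewrite c1.
Qed.
End Matchings.

(** * Exchanging two matchings on a component *)

Section Exchange.
Local Open Scope set_scope.
Variables (N n : nat) (G : bgraph N n).
Local Notation V := 'I_(N + n).
Implicit Types (M : {set {set V}}) (f : {set V}) (C : {pred V}).

(** The first matching after trading its edges that meet C for those of the second.
    The edges are sorted by disjointness from C; for a union C of components this is the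
    same as testing any one endpoint. *)
Definition exchange C M1 M2 :=
  [set f in M1 | [disjoint f & C]] :|: [set f in M2 | ~~ [disjoint f & C]].

Lemma exchangeK C M1 M2 :
  exchange C (exchange C M1 M2) (exchange C M2 M1) = M1.
Proof.
by apply/setP => f; rewrite !inE; case: [disjoint f & C]; rewrite ?andbT ?andbF ?orbF.
Qed.

Lemma superposed_exchange C M1 M2 :
  superposed (exchange C M1 M2) (exchange C M2 M1) =2 superposed M1 M2.
Proof.
move=> u v; rewrite /superposed !inE.
case: [disjoint _ & C]; rewrite ?andbT ?andbF ?orbF //=.
by rewrite orbC.
Qed.

Lemma mem_exchange C M1 M2 f v :
  M1 \subset edges G -> M2 \subset edges G -> fingraph.closed (superposed M1 M2) C ->
  v \in f -> (f \in exchange C M1 M2) = (f \in if v \in C then M2 else M1).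
Proof.
move=> M1G M2G clC vf; rewrite !inE.
have [fM|nfM] := boolP ((f \in M1) || (f \in M2)); last first.
  by move: nfM; rewrite negb_or => /andP [/negPf f1 /negPf f2]; case: ifP; rewrite f1 f2.
have [u [w [_ fE]]] : exists u w, adj G u w /\ f = [set u; w].
  by apply/edgesP; case/orP: fM => fM; apply: fintype.subsetP fM.
have uw : (u \in C) = (w \in C) by apply: clC; rewrite /superposed inE -fE.
have -> : [disjoint f & C] = (v \notin C).
  apply/idP/idP => [/disjointFr -> //|nv].
  apply/pred0Pn => -[x /andP [/= xf xC]]; move: nv.
  have : (u \in C) by move: xf xC; rewrite fE !inE => /orP [] /eqP ->; rewrite ?uw.
  by move=> uC; move: vf; rewrite fE !inE => /orP [] /eqP ->; rewrite -?uw uC.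
by case: (v \in C); rewrite ?andbT ?andbF ?orbF.
Qed.

Lemma covered_exchange C M1 M2 v :
  M1 \subset edges G -> M2 \subset edges G -> fingraph.closed (superposed M1 M2) C ->
  covered (exchange C M1 M2) v = covered (if v \in C then M2 else M1) v.
Proof.
move=> M1G M2G clC; apply: eq_existsb => f.
have [vf|] := boolP (v \in f); last by rewrite !andbF.
by rewrite !andbT (mem_exchange M1G M2G clC vf).
Qed.

Lemma perfect_exchange C M1 M2 :
  perfect_matching G M1 -> perfect_matching G M2 -> fingraph.closed (superposed M1 M2) C ->
  perfect_matching G (exchange C M1 M2).
Proof.
move=> /perfect_matchingP [M1G M1u M1c] /perfect_matchingP [M2G M2u M2c] clC.
apply/perfect_matchingP; split.
- apply/fintype.subsetP => f; rewrite !inE => /orP [] /andP [fM _];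
  [have := fintype.subsetP M1G _ fM|have := fintype.subsetP M2G _ fM]; by rewrite inE.
- move=> v f g fM gM vf vg; move: fM gM.
  rewrite (mem_exchange M1G M2G clC vf) (mem_exchange M1G M2G clC vg).
  by case: ifP => _ fM gM; [apply: M2u vf vg|apply: M1u vf vg].
- by move=> i; rewrite covered_exchange //; case: ifP.
Qed.
End Exchange.

Definition rank (n : nat) (I : {set 'I_n}) (b : 'I_n) : nat :=
  #|[set j in I | (j < b)%N]%SET|.

(** For b in I the default b is never returned: see [partnerP]. *)
Definition partner (N n : nat) (e : rel 'I_(N + n)) (I : {set 'I_n}) (b : 'I_n) : 'I_n :=
  odflt b [pick q in I | (q != b) && connect e (rshift N b) (rshift N q)].

Section Partner.
Local Open Scope set_scope.
Variables (R : realType) (N n : nat) (G : bgraph N n) (emb : disc_embedding R G).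
Variables (M1 M2 : {set {set 'I_(N + n)}}) (I : {set 'I_n}).
Hypotheses (pm1 : perfect_matching G M1) (pm2 : perfect_matching G M2).
Hypothesis boundaryI : forall j,
  covered M1 (rshift N j) (+) covered M2 (rshift N j) = (j \in I).
Local Notation e := (superposed M1 M2).
Local Notation conn b q := (connect e (rshift N b) (rshift N q)).
Local Notation mate_of := (partner e I).

Let csym : connect_sym e.
Proof. exact: sym_connect_sym (superposed_sym M1 M2). Qed.

Lemma partnerP b : b \in I ->
  [/\ mate_of b \in I, mate_of b != b, conn b (mate_of b)
    & forall r, r \in I -> conn b r -> r = b \/ r = mate_of b].
Proof.
move=> bI.
have [|y [yb by_ yc yu]] := @superposed_end _ _ G M1 M2 (rshift N b) pm1 pm2.
  by rewrite boundaryI.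
have [i yE|q yE] := split_ordP y.
  have [_ _ c1] := perfect_matchingP _ _ pm1; have [_ _ c2] := perfect_matchingP _ _ pm2.
  by rewrite yE c1 c2 in yc.
rewrite yE in yb by_ yc yu; rewrite boundaryI in yc.
have qb : q != b by apply: contraNneq yb => ->.
have uniq_q r : r \in I -> conn b r -> r = b \/ r = q.
  rewrite -boundaryI => rI br; have [] := yu _ br rI; move/rshift_inj; [left|right] => //.
rewrite /partner; case: pickP => [r /= /and3P [rI rb br]|/(_ q)]; last first.
  by rewrite /= yc qb by_.
have rq : r = q by case: (uniq_q r rI br) => // rb'; rewrite rb' eqxx in rb.
by rewrite rq; split.
Qed.

Lemma partner_uniq b r : b \in I -> r \in I -> conn b r -> r != b -> mate_of b = r.
Proof.
move=> bI rI br rb; have [_ _ _ /(_ r rI br)] := partnerP bI.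
by case=> // rb'; rewrite rb' eqxx in rb.
Qed.

Lemma partnerK b : b \in I -> mate_of (mate_of b) = b.
Proof.
move=> bI; have [qI qb bq _] := partnerP bI.
by apply: partner_uniq => //; rewrite 1?csym // eq_sym.
Qed.

(** Planarity: the path from j may not cross the one from b. *)
Lemma partner_between b j : b \in I -> j \in I ->
  (b < j)%N -> (j < mate_of b)%N -> (b < mate_of j)%N && (mate_of j < mate_of b)%N.
Proof.
move=> bI jI bj jq; have [qI qb bq qu] := partnerP bI; have [rI rj jr ru] := partnerP jI.
set q := mate_of b in qI qb bq qu jq *; set r := mate_of j in rI rj jr ru *.
have eG u v : e u v -> u != v -> adj G u v.
  have [[M1G _ _] [M2G _ _]] := (perfect_matchingP _ _ pm1, perfect_matchingP _ _ pm2).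
  rewrite /superposed inE => /orP uv _; apply: edge_adj.
  by case: uv => uv; apply: fintype.subsetP uv.
have nbj : ~~ conn b j.
  apply/negP => /(qu j jI) [jb|jq']; first by rewrite jb ltnn in bj.
  by rewrite jq' ltnn in jq.
have cross := noncrossing emb (superposed_sym M1 M2) eG.
apply/andP; split; rewrite ltnNge leq_eqVlt; apply/norP; split.
- apply: contra nbj => /eqP/val_inj rb; by rewrite csym -rb.
- apply: contra nbj => rb; have rbc : conn r b by apply: cross rb bj jq _ bq; rewrite csym.
  by rewrite csym; apply: connect_trans jr rbc.
- apply: contra nbj => /eqP/val_inj qr; by apply: connect_trans bq _; rewrite qr csym.
- apply: contra nbj => qr; exact: cross bj jq qr bq jr.
Qed.

(** By [partner_between], the elements of I strictly between b and its partner are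
    paired off among themselves, so their number is even. *)
Lemma partner_rank b : b \in I -> odd (rank I (mate_of b)) = ~~ odd (rank I b).
Proof.
have key c : c \in I -> (c < mate_of c)%N -> odd (rank I (mate_of c)) = ~~ odd (rank I c).
  move=> cI cq; have [qI qc _ _] := partnerP cI.
  pose A := [set j in I | (c < j)%N && (j < mate_of c)%N].
  have evenA : ~~ odd #|A|.
    apply: (@even_card_involution _ _ (partner e I)) => j.
    rewrite !inE => /and3P [jI cj jq]; have [rI rj jr _] := partnerP jI.
    by split=> //; [rewrite rI partner_between|exact: partnerK].
  have -> : rank I (mate_of c) = (rank I c + (1 + #|A|))%N.
    have cA : c \notin A by rewrite inE ltnn andbF.
    have := cardsU1 c A; rewrite cA => <-.
    rewrite /rank -(cardsID [set j : 'I_n | (j < c)%N]); congr (_ + _)%N; apply: eq_card => j.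
      by rewrite !inE; case: (ltnP j c) => jc; rewrite ?andbT ?andbF // (ltn_trans jc cq) andbT.
    rewrite !inE -leqNgt; case: (ltngtP c j) => [cj|jc|/val_inj <-] //=.
      by rewrite -(inj_eq val_inj) /= gtn_eqF.
      by rewrite -(inj_eq val_inj) /= ltn_eqF ?andbF.
    by rewrite eqxx cI cq.
  by rewrite oddD /= evenA addbT.
move=> bI; have [qI qb _ _] := partnerP bI.
case: (ltngtP b (mate_of b)) => [|qltb|/val_inj bq]; first exact: key.
  by have := key _ qI; rewrite partnerK // => ->; rewrite ?negbK.
by rewrite -bq eqxx in qb.
Qed.
End Partner.

(** * The quadratic relation between matching counts *)

Section Condensation.
Local Open Scope set_scope.
Variables (R : realType) (N n : nat) (G : bgraph N n) (emb : disc_embedding R G).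
Local Notation matching := {set {set 'I_(N + n)}}.

(** The symmetric difference of {a} and {b}.  It is empty for a = b, which lets the term
    D(empty) D(I) of the relation be treated like all others. *)
Definition toggled (a b : 'I_n) : {set 'I_n} := [set x | (x == a) (+) (x == b)].

Definition matchings_with (I : {set 'I_n}) : {set matching} :=
  [set M | perfect_matching G M & matching_boundary M == I].

Lemma matchings_withP (I : {set 'I_n}) (M : matching) :
  reflect (perfect_matching G M /\ forall j, covered M (rshift N j) = (j \in I))
          (M \in matchings_with I).
Proof.
rewrite inE; apply: (iffP andP) => -[pm bI]; split=> //.
  by move=> j; rewrite -(eqP bI) inE.
by apply/eqP/setP => j; rewrite inE; apply: bI.
Qed.

Definition superpositions (I : {set 'I_n}) (a : 'I_n)
    : {set 'I_n * (matching * matching)} :=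
  [set t | [&& t.1 \in I, t.2.1 \in matchings_with (toggled a t.1)
             & t.2.2 \in matchings_with (I :\: toggled a t.1)]].

Definition flip (I : {set 'I_n}) (t : 'I_n * (matching * matching)) :=
  let e := superposed t.2.1 t.2.2 in let C := connect e (rshift N t.1) in
  (partner e I t.1, (exchange C t.2.1 t.2.2, exchange C t.2.2 t.2.1)).

(** Exchanging along the path from b to q toggles exactly b and q in both boundaries, so
    the triple of b becomes a triple of q.  The union of the matchings is unchanged, hence so
    are the paths, and a second flip starts from q and undoes the first. *)
Lemma flipP (I : {set 'I_n}) (a : 'I_n) t : a \in I -> t \in superpositions I a ->
  [/\ flip I t \in superpositions I a, flip I (flip I t) = t
    & odd (rank I (flip I t).1) = ~~ odd (rank I t.1)].
Proof.
case: t => b [M1 M2] aI; rewrite inE /= => /and3P [bI].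
move=> /matchings_withP [pm1 b1] /matchings_withP [pm2 b2].
have [[M1G _ _] [M2G _ _]] := (perfect_matchingP _ _ pm1, perfect_matchingP _ _ pm2).
have inI j k : k \in I -> (j == k) ==> (j \in I).
  by move=> kI; apply/implyP => /eqP ->.
have bdI j : covered M1 (rshift N j) (+) covered M2 (rshift N j) = (j \in I).
  rewrite b1 b2 !inE; move: (inI j a aI) (inI j b bI).
  by case: (j == a); case: (j == b); case: (j \in I).
have csym : connect_sym (superposed M1 M2) := sym_connect_sym (superposed_sym M1 M2).
have [qI qb bq qu] := partnerP pm1 pm2 bdI bI.
rewrite /flip /=; set C := connect _ _; set q := partner _ I b in qI qb bq qu *.
have clC : fingraph.closed (superposed M1 M2) C by apply: connect_closed.
have clC' : fingraph.closed (superposed M2 M1) C.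
  by move=> u v; rewrite /superposed (finset.setUC M2); apply: clC.
have bC : rshift N b \in C by exact: connect0.
have qC : rshift N q \in C by [].
(* The next facts determine membership of j in all the sets involved: on C the only
   elements of I are b and q, and off C there is neither. *)
have C_I j : if rshift N j \in C then (j \in I) ==> (j == b) || (j == q)
             else (j != b) && (j != q).
  case: ifP => jC; first by apply/implyP => /qu /(_ jC) [] ->; rewrite eqxx ?orbT.
  by apply/andP; split; apply: contraFneq jC => ->.
have neq_bq j : ~~ ((j == b) && (j == q)).
  by apply: contraNN qb => /andP [/eqP <- /eqP ->].
have qC' : connect (superposed M1 M2) (rshift N q) =1 C.
  by move=> v; apply/idP/idP; apply: connect_trans => //; rewrite csym.
split.
- rewrite inE; apply/and3P; split=> /=; [exact: qI|apply/matchings_withP|apply/matchings_withP]; split.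
  + exact: perfect_exchange.
  + move=> j; rewrite (covered_exchange _ M1G M2G clC).
    move: (C_I j) (inI j a aI) (inI j b bI) (inI j q qI) (neq_bq j).
    case: ifP => _; rewrite ?b1 ?b2 !inE;
    by case: (j == a); case: (j == b); case: (j == q); case: (j \in I).
  + exact: perfect_exchange.
  + move=> j; rewrite (covered_exchange _ M2G M1G clC').
    move: (C_I j) (inI j a aI) (inI j b bI) (inI j q qI) (neq_bq j).
    case: ifP => _; rewrite ?b1 ?b2 !inE;
    by case: (j == a); case: (j == b); case: (j == q); case: (j \in I).
- set e' := superposed _ _.
  have e'E : connect e' =2 connect (superposed M1 M2).
    exact/eq_connect/superposed_exchange.
  have exC M M' : exchange (connect e' (rshift N q)) M M' = exchange C M M'.
    have CE : connect e' (rshift N q) =1 C by move=> v; rewrite e'E qC'.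
    apply/setP => f; rewrite !inE; congr (_ && _ || _ && ~~ _); exact: eq_disjoint_r.
  rewrite !exC !exchangeK; congr (_, _).
  rewrite -[RHS](partnerK pm1 pm2 bdI bI) -/q /partner.
  by congr odflt; apply: eq_pick => r; rewrite /= e'E.
- exact: (partner_rank emb pm1 pm2 bdI bI).
Qed.

(** All terms cancel in pairs under [flip]. *)
Lemma pfaffian_condensation (I : {set 'I_n}) (a : 'I_n) : a \in I ->
  \sum_(b in I) (-1) ^+ rank I b *
    (num_matchings G (toggled a b) * num_matchings G (I :\: toggled a b))%:R = 0 :> R.
Proof.
move=> aI; pose w (t : 'I_n * (matching * matching)) : R := (-1) ^+ rank I t.1.
have -> : \sum_(b in I) (-1) ^+ rank I b *
    (num_matchings G (toggled a b) * num_matchings G (I :\: toggled a b))%:R =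
    \sum_(t in superpositions I a) w t.
  rewrite (eq_bigl (fun t => (t.1 \in I) && (t.2 \in finset.setX (matchings_with (toggled a t.1))
      (matchings_with (I :\: toggled a t.1))))); last first.
    by move=> t; rewrite !inE.
  rewrite -(pair_big_dep (mem I) (fun b p => p \in finset.setX (matchings_with (toggled a b))
      (matchings_with (I :\: toggled a b))) (fun b _ => (-1) ^+ rank I b)) /=.
  by apply: eq_bigr => b _; rewrite sumr_const cardsX mulr_natr.
set S := \sum_(t in _) _.
suff SN : S = - S by move: SN; lra.
rewrite {1}/S (reindex_onto (flip I) (flip I)) => [|t /(flipP aI) [] //].
rewrite -sumrN; apply: eq_big => [t|t /andP [tX /eqP tK]].
  apply/andP/idP => [[tX /eqP tK]|/(flipP aI) [-> -> _] //].
  by rewrite -tK; have [] := flipP aI tX.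
have [_ _] := flipP aI tX; rewrite tK /w -!(signr_odd _ (rank I _)) => ->.
by rewrite signrN opprK.
Qed.
End Condensation.

(** * Expansion of the Pfaffian along the first row *)

Section Pfaffian.
Variable R : numFieldType.

Lemma lift_perm_inj n (i j : 'I_n.+1) : injective (lift_perm i j).
Proof.
move=> s t st; apply/permP => k; apply: (@lift_inj _ j).
by rewrite -!(lift_perm_lift i) st.
Qed.

Lemma lift_perm_surj n (i j : 'I_n.+1) (s : 'S_n.+1) :
  s i = j -> exists t, s = lift_perm i j t.
Proof.
move=> sij.
have liftE k : exists k', s (lift i k) == lift j k'.
  case: (unliftP j (s (lift i k))) => [k' ->|]; first by exists k'.
  by rewrite -sij => /perm_inj/eqP; rewrite eq_sym (negPf (neq_lift _ _)).
pose t k := xchoose (liftE k).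
have tE k : s (lift i k) = lift j (t k) := eqP (xchooseP (liftE k)).
have t_inj : injective t.
  by move=> k l tkl; apply: (@lift_inj _ i); apply: (@perm_inj _ s); rewrite !tE tkl.
exists (perm t_inj); apply/permP => k.
case: (unliftP i k) => [k'|] ->; last by rewrite lift_perm_id.
by rewrite lift_perm_lift permE tE.
Qed.

Lemma sum_lift_perm n (i j : 'I_n.+1) (F : 'S_n.+1 -> R) :
  \sum_(s : 'S_n.+1 | s i == j) F s = \sum_(t : 'S_n) F (lift_perm i j t).
Proof.
rewrite (eq_bigl (mem (lift_perm i j @: [set: 'S_n]%SET))); last first.
  move=> s; apply/eqP/imsetP => [/lift_perm_surj [t ->]|[t _ ->]]; last exact: lift_perm_id.
  by exists t; rewrite ?inE.
rewrite big_imset /=; last by move=> s t _ _ /lift_perm_inj.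
by apply: eq_bigl => t; rewrite inE.
Qed.

Definition Pf_term k (A : 'M[R]_k) (s : 'S_k) : R :=
  (-1) ^+ s * \prod_(i < k | ~~ odd i) A (s i) (s (ordS i)).

Lemma odd_ordS k (i : 'I_k) : ~~ odd k -> odd (ordS i) = ~~ odd i.
Proof.
move=> evenk /=; have := ltn_ord i; rewrite leq_eqVlt => /orP [/eqP ik|ik].
  have /= := congr1 odd ik; rewrite (negPf evenk) => /negbFE oddi.
  by rewrite ik modnn oddi.
by rewrite modn_small.
Qed.

(** Exchanging two blocks (p, p + 1) and (q, q + 1) is an even permutation and only
    reorders the factors. *)
Lemma Pf_term_swap_blocks k (A : 'M[R]_k) (p q : 'I_k) (s : 'S_k) :
  ~~ odd k -> ~~ odd p -> ~~ odd q ->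
  Pf_term A (tperm p q * tperm (ordS p) (ordS q) * s)%g = Pf_term A s.
Proof.
move=> evenk evenp evenq; set t := (_ * tperm _ _)%g.
have ne_odd (i j : 'I_k) : odd i != odd j -> i != j by apply: contraNneq => ->.
have pq_even (i : 'I_k) : ~~ odd i -> odd (tperm p q i) = false.
  by move=> /negPf eveni; case: tpermP => [_|_|_ _]; rewrite ?(negPf evenp) ?(negPf evenq).
have tE (i : 'I_k) : ~~ odd i -> t i = tperm p q i.
  move=> eveni; rewrite permM tpermD //; apply: ne_odd;
    by rewrite odd_ordS // pq_even // ?evenp ?evenq.
have tS (i : 'I_k) : ~~ odd i -> t (ordS i) = ordS (t i).
  move=> eveni; rewrite (tE i) // (inj_tperm _ _ _ (@ordS_inj k)) permM.
  congr (tperm _ _ _); rewrite tpermD //; apply: ne_odd;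
    by rewrite odd_ordS // eveni ?(negPf evenp) ?(negPf evenq).
have t_even (i : 'I_k) : ~~ odd (t i) = ~~ odd i.
  have [oddi|eveni] := boolP (odd i); last by rewrite tE // pq_even.
  have [j -> evenj] : exists2 j, i = ordS j & ~~ odd j.
    by exists (ord_pred i); rewrite ?ord_predK // -odd_ordS // ord_predK.
  by rewrite tS // odd_ordS // tE // pq_even.
rewrite /Pf_term odd_permM; congr (_ * _).
  by rewrite /t odd_permM !odd_tperm (inj_eq (@ordS_inj k)) addbb.
rewrite [RHS](reindex_inj (@perm_inj _ t)) /=; apply: eq_big => i; first by rewrite t_even.
by move=> eveni; rewrite -tS // -!(permM t s).
Qed.

(** Exchanging the two positions of a block changes the sign of the permutation, and by
    skew symmetry the sign of one factor. *)
Lemma Pf_term_flip_block k (A : 'M[R]_k) (p : 'I_k) (s : 'S_k) :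
  A^T = - A -> ~~ odd k -> ~~ odd p ->
  Pf_term A (tperm p (ordS p) * s)%g = Pf_term A s.
Proof.
move=> skew evenk evenp.
have skewE i j : A i j = - A j i by move/matrixP/(_ j i): skew; rewrite !mxE.
have ne_odd (i j : 'I_k) : odd i != odd j -> i != j by apply: contraNneq => ->.
have pS : p != ordS p by apply: ne_odd; rewrite odd_ordS // (negPf evenp).
rewrite /Pf_term odd_permM odd_tperm pS signr_addb mulN1r.
rewrite (bigD1 p) // [in RHS](bigD1 p) //= !permM tpermL tpermR skewE.
rewrite !mulNr mulrN opprK; congr (_ * (_ * _)).
apply: eq_bigr => i /andP [eveni ip]; rewrite !permM.
have pi : p != i by rewrite eq_sym.
have Spi : ordS p != i by apply: ne_odd; rewrite odd_ordS // evenp (negPf eveni).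
have pSi : p != ordS i by apply: ne_odd; rewrite odd_ordS // eveni (negPf evenp).
by rewrite !tpermD // (inj_eq (@ordS_inj k)).
Qed.
End Pfaffian.

Section PfaffianExpansion.
Variable R : numFieldType.

(** The increasing enumeration of the indices other than 0 and j + 1. *)
Definition lift2 k (j : 'I_k.+1) (i : 'I_k) : 'I_k.+2 := lift ord0 (lift j i).

(** Sort the permutations by the position p of the value 0.  Flipping a block moves p to an
    even position, and swapping blocks then moves it to 0, without changing the term: all
    the k + 2 positions contribute equally. *)
Lemma sum_Pf_term k (A : 'M[R]_k.+2) : A^T = - A -> ~~ odd k ->
  \sum_s Pf_term A s = k.+2%:R * \sum_(s : 'S_k.+2 | s ord0 == ord0) Pf_term A s.
Proof.
move=> skew evenk.
have evenk2 : ~~ odd k.+2 by rewrite /= negbK.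
have base_even (p : 'I_k.+2) : ~~ odd p ->
    \sum_(s : 'S_k.+2 | s p == ord0) Pf_term A s =
    \sum_(s : 'S_k.+2 | s ord0 == ord0) Pf_term A s.
  move=> evenp.
  rewrite (reindex_inj (mulgI (tperm ord0 p * tperm (ordS ord0) (ordS p))%g)) /=.
  apply: eq_big => [s|s _]; last exact: Pf_term_swap_blocks.
  have S0 (i : 'I_k.+2) : ~~ odd i -> ordS i != ord0.
    by move=> eveni; apply/eqP => Si; have := odd_ordS i evenk2; rewrite Si eveni.
  by rewrite !permM tpermR tpermD // S0.
have base (p : 'I_k.+2) :
    \sum_(s : 'S_k.+2 | s p == ord0) Pf_term A s =
    \sum_(s : 'S_k.+2 | s ord0 == ord0) Pf_term A s.
  have [oddp|/base_even //] := boolP (odd p).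
  pose q := ord_pred p; have pq : p = ordS q by rewrite /q ord_predK.
  have evenq : ~~ odd q by rewrite -odd_ordS // -pq.
  rewrite -(base_even q evenq) (reindex_inj (mulgI (tperm q (ordS q)))) /=.
  apply: eq_big => [s|s _]; last exact: Pf_term_flip_block.
  by rewrite pq permM tpermR.
rewrite (partition_big (fun s : 'S_k.+2 => (s^-1)%g ord0) xpredT) //=.
rewrite (eq_bigr (fun _ => \sum_(s : 'S_k.+2 | s ord0 == ord0) Pf_term A s)).
  by rewrite sumr_const card_ord -[LHS]mulr_natl.
move=> p _; rewrite -(base p); apply: eq_bigl => s.
by rewrite -[RHS](inj_eq (@perm_inj _ s^-1%g)) permK eq_sym.
Qed.

Lemma Pf_term_lift k (A : 'M[R]_k.+2) (j : 'I_k.+1) (s : 'S_k) : ~~ odd k ->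
  Pf_term A (lift_perm ord0 ord0 (lift_perm ord0 j s)) =
  (-1) ^+ j * A ord0 (lift ord0 j) * Pf_term (mxsub (lift2 j) (lift2 j) A) s.
Proof.
move=> evenk; set s2 := lift_perm _ _ _.
have s2_0 : s2 ord0 = ord0 by rewrite lift_perm_id.
have s2_1 : s2 (ordS ord0) = lift ord0 j.
  have -> : ordS ord0 = lift ord0 ord0 :> 'I_k.+2 by apply: val_inj.
  by rewrite lift_perm_lift lift_perm_id.
have s2_lift i : s2 (lift ord0 (lift ord0 i)) = lift2 j (s i).
  by rewrite !lift_perm_lift.
rewrite /Pf_term !odd_lift_perm /= signr_addb signr_odd -!mulrA; congr (_ * _).
rewrite [RHS]mulrCA; congr (_ * _).
rewrite big_mkcond big_ord_recl big_ord_recl /= mul1r s2_0 s2_1; congr (_ * _).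
rewrite [RHS]big_mkcond; apply: eq_bigr => i _ /=; rewrite negbK.
case: ifP => // eveni; rewrite mxE -!s2_lift; congr (A _ (s2 _)).
apply: val_inj => /=.
have iS : (i.+1 < k)%N.
  by rewrite ltn_neqAle ltn_ord andbT; apply: contraNneq evenk => <-; rewrite /= eveni.
by rewrite !modn_small.
Qed.

(** By [sum_Pf_term] one may assume s(0) = 0; the value j + 1 of s(1) then selects the
    entry of the first row, and the factor k + 2 turns the normalization of size k + 2 into
    that of size k. *)
Lemma Pf_expand k (A : 'M[R]_k.+2) : A^T = - A ->
  Pf A = \sum_(j < k.+1)
    (-1) ^+ j * A ord0 (lift ord0 j) * Pf (mxsub (lift2 j) (lift2 j) A).
Proof.
move=> skew; have [oddk|evenk] := boolP (odd k).
  rewrite big1 => [|j _]; first by rewrite /Pf /= negbK oddk.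
  by rewrite /Pf oddk mulr0.
rewrite [LHS]/Pf /= negbK (negPf evenk) -/(Pf_term A).
have -> : \sum_s (-1) ^+ (odd_perm s) * \prod_(i < k.+2 | ~~ odd i) A (s i) (s (ordS i))
  = \sum_s Pf_term A s by [].
rewrite sum_Pf_term // sum_lift_perm.
rewrite (partition_big (fun s : 'S_k.+1 => s ord0) xpredT) //=.
rewrite !mulr_sumr; apply: eq_bigr => j _.
rewrite sum_lift_perm (eq_bigr _ (fun s _ => Pf_term_lift A j s evenk)) -mulr_sumr.
have kE : k.+2%:R = 2 * (k./2.+1)%:R :> R.
  by rewrite -natrM; congr (_%:R); have := odd_double_half k; rewrite (negPf evenk); lia.
have coef : (2 ^ (k./2).+1 * (k./2).+1`!)%:R^-1 * k.+2%:R = (2 ^ k./2 * k./2`!)%:R^-1 :> R.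
  rewrite kE expnS factS !natrM; field.
  by rewrite nat1r !pnatr_eq0 -lt0n fact_gt0 expn_eq0.
by rewrite [LHS]mulrA coef [in RHS]/Pf (negPf evenk) mulrCA.

Qed.
End PfaffianExpansion.

(** * The Pfaffian formula *)

Lemma enum_val_lt n (I : {set 'I_n}) (i j : 'I_#|I|) :
  (i < j)%N -> (enum_val i < enum_val j)%N.
Proof.
move=> ij; have sorted_enum : sorted ltn (map val (enum I)).
  apply: subseq_sorted (iota_ltn_sorted 0 n); first exact: ltn_trans.
  by rewrite -val_enum_ord; apply: map_subseq; rewrite !enumT /enum_mem; apply: filter_subseq.
have size_i (l : 'I_#|I|) : (l < size (map val (enum I)))%N by rewrite size_map -cardE.
have x0 := enum_val i.
have valE (l : 'I_#|I|) : val (enum_val l) = nth 0%N (map val (enum I)) l.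
  by rewrite (nth_map x0) -?cardE // (enum_val_nth x0).
by have := sorted_ltn_nth ltn_trans 0%N sorted_enum _ _ (size_i i) (size_i j) ij; rewrite -!valE.
Qed.

Section PfaffianFormula.
Local Open Scope set_scope.

Lemma rank_imset n k (phi : 'I_k -> 'I_n) (i : 'I_k) :
  (forall i j : 'I_k, (i < j)%N -> (phi i < phi j)%N) ->
  rank (phi @: 'I_k) (phi i) = i.
Proof.
move=> phi_lt; have phi_inj : injective phi.
  move=> x y; case: (ltngtP x y) => [/phi_lt|/phi_lt|/val_inj //] xy e;
  by rewrite e ltnn in xy.
have -> : rank (phi @: 'I_k) (phi i) = #|phi @: [set j : 'I_k | (j < i)%N]|.
  apply: eq_card => x; rewrite inE; apply/andP/imsetP => [[/imsetP [j _ ->] ji]|[j]].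
    exists j; rewrite // inE ltnNge; apply/negP; rewrite leq_eqVlt.
    case/orP => [/eqP/val_inj ij|/phi_lt ij]; first by rewrite ij ltnn in ji.
    by have := ltn_trans ij ji; rewrite ltnn.
  by rewrite inE => /phi_lt ji ->; rewrite imset_f.
rewrite card_imset // -sum1_card (eq_bigl (fun j : 'I_k => (j < i)%N)).
  by rewrite -(big_ord_widen k (fun=> 1%N) (ltnW (ltn_ord i))) sum1_card card_ord.
by move=> j; rewrite inE.
Qed.

Definition pairing_matrix (R : realType) N n (G : bgraph N n) : 'M[R]_n :=
  \matrix_(i, j)
    ((if (i < j)%N then 1 else if (j < i)%N then -1 else 0) *
     ((num_matchings G [set i; j])%:R / (num_matchings G finset.set0)%:R)).

Lemma pairing_matrix_skew (R : realType) N n (G : bgraph N n) :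
  (pairing_matrix R G)^T = - pairing_matrix R G.
Proof.
apply/matrixP => i j; rewrite !mxE finset.setUC -mulNr; congr (_ * _).
by case: ltngtP; rewrite ?opprK ?oppr0.
Qed.

Lemma toggledid n (a : 'I_n) : toggled a a = finset.set0.
Proof. by apply/setP => x; rewrite !inE addbb. Qed.

Lemma toggled_neq n (a b : 'I_n) : a != b -> toggled a b = [set a; b].
Proof.
move=> ab; apply/setP => x; rewrite !inE.
by case: (eqVneq x a) => [->|_] //=; rewrite (negPf ab).
Qed.

(** The sets I are presented by increasing enumerations phi, so that the submatrix
    without the rows and columns 0 and j + 1 is again of this form, with no
    identification of the index types.  In [pfaffian_condensation] for a = phi 0,
    isolating the term of a leaves the row expansion. *)
Lemma num_matchings_Pf (R : realType) N n (G : bgraph N n) (emb : disc_embedding R G)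
    k (phi : 'I_k -> 'I_n) :
  (0 < num_matchings G finset.set0)%N ->
  (forall i j : 'I_k, (i < j)%N -> (phi i < phi j)%N) ->
  (num_matchings G (phi @: 'I_k))%:R =
  Pf (mxsub phi phi (pairing_matrix R G)) * (num_matchings G finset.set0)%:R.
Proof.
move=> hG; set d : R := (num_matchings G finset.set0)%:R.
have d0 : d != 0 by rewrite pnatr_eq0 -lt0n.
set Y := pairing_matrix R G.
have [m] := ubnP k; elim: m => // m IHm in k phi * => le_km phi_lt.
have phi_inj : injective phi.
  move=> x y; case: (ltngtP x y) => [/phi_lt|/phi_lt|/val_inj //] xy e;
  by rewrite e ltnn in xy.
case: k phi phi_lt phi_inj le_km => [|k] phi phi_lt phi_inj le_km.
  have -> : phi @: 'I_0 = finset.set0.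
    by apply/setP => x; rewrite inE; apply/imsetP => -[[]].
  rewrite /Pf /= mul1n invr1 mul1r (bigD1 1%g) //= odd_perm1 big_ord0 mulr1.
  rewrite big1 ?addr0 ?mul1r // => s; case/eqP; apply/permP; by case.
set a := phi ord0; set I := phi @: 'I_k.+1.
have aI : a \in I by rewrite imset_f.
have := pfaffian_condensation emb aI; rewrite big_imset /=; last by move=> x y _ _ /phi_inj.
rewrite big_ord_recl /= (rank_imset _ phi_lt) expr0 mul1r toggledid finset.setD0 natrM -/d.
move/eqP; rewrite addr_eq0 => /eqP dI.
case: k phi phi_lt phi_inj le_km @a @I aI dI => [|k] phi phi_lt phi_inj le_km a I aI dI.
  (* For I = {a} the relation reads D(empty) D(I) = 0. *)
  by rewrite /Pf /= mul0r; apply: (mulfI d0); rewrite dI big_ord0 oppr0 mulr0.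
apply: (mulfI d0); rewrite dI Pf_expand; last first.
  apply/matrixP => i j; rewrite !mxE.
  by have /matrixP/(_ (phi i) (phi j)) := pairing_matrix_skew R G; rewrite !mxE.
rewrite -sumrN mulr_suml mulr_sumr; apply: eq_bigr => j _.
have lt0j : (phi ord0 < phi (lift ord0 j))%N by apply: phi_lt.
have nej : a != phi (lift ord0 j) by rewrite /a (inj_eq phi_inj) neq_lift.
have sub : (phi \o lift2 j) @: 'I_k = I :\: [set a; phi (lift ord0 j)].
  apply/setP => x; rewrite !inE negb_or; apply/imsetP/idP => [[i _ ->]|].
    apply/andP; split; last exact: imset_f.
    by apply/andP; split; rewrite /a /= /lift2 (inj_eq phi_inj)
      ?(inj_eq (@lift_inj _ _)) eq_sym neq_lift.
  case/andP=> /andP [xa xj] /imsetP [i _ xi]; move: xa xj; rewrite xi !(inj_eq phi_inj).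
  case: (unliftP ord0 i) => [i' ->|-> //]; rewrite (inj_eq (@lift_inj _ _)) => _.
  case: (unliftP j i') => [l ->|->]; last by rewrite eqxx.
  by exists l.
have IH : (num_matchings G ((phi \o lift2 j) @: 'I_k))%:R =
    Pf (mxsub (lift2 j) (lift2 j) (mxsub phi phi Y)) * d.
  rewrite -mxsub_comp; apply: IHm; first by lia.
  by move=> x y xy; apply: phi_lt; rewrite /lift2 /= /bump; lia.
(* The position of phi (lift ord0 j) is j + 1, which accounts for the sign of dI. *)
rewrite rank_imset // toggled_neq // natrM -sub IH !mxE lt0j mul1r -/d.
by rewrite /= /bump /= exprS; field.
Qed.
End PfaffianFormula.

Theorem theorem6 (R : realType) (N n : nat) (G : bgraph N n)
    (emb : disc_embedding R G)
    (hG : (0 < num_matchings G (finset.set0 : {set 'I_n}))%N) :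
  exists Y : 'M[R]_n, Y^T = - Y /\
    forall I : {set 'I_n},
      (num_matchings G I)%:R =
        Pf (principal_submx Y I) *
          (num_matchings G (finset.set0 : {set 'I_n}))%:R :> R.
Proof.
exists (pairing_matrix R G); split; first exact: pairing_matrix_skew.
move=> I; have := num_matchings_Pf emb hG (@enum_val_lt n I).
suff -> : (@enum_val _ (mem I) @: 'I_#|I|)%SET = I by [].
apply/setP => x; apply/imsetP/idP => [[i _ ->]|xI]; first exact: enum_valP.
by exists (enum_rank_in xI x); rewrite ?enum_rankK_in.
Qed.
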